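(* Let $K$ be a field and let $\mathbb{X}=\{p_1,\dots,p_s\}\subseteq\mathbb{P}^n_K$ be a $(2,r_{\mathbb{X}}-1)$-uniform set of $s$ distinct $K$-rational points, none on the hyperplane $X_0=0$. Suppose that $\mathbb{X}$ is an almost Gorenstein scheme and $r_{\mathbb{X}}\ge2$. Then $\Delta_{\mathbb{X}}=1$, where $\Delta_{\mathbb{X}}=\deg(\mathbb{X})-\mathrm{HF}_{\mathbb{X}}(r_{\mathbb{X}}-1)$.
   Context: $P=K[X_0,\dots,X_n]$ has the standard grading, $I_{\mathbb{X}}\subseteq P$ is the homogeneous vanishing ideal of $\mathbb{X}$ (with reduced structure), $R=P/I_{\mathbb{X}}$ with homogeneous maximal ideal $\mathfrak{m}$, and $x_0$ is the residue class of $X_0$, a non-zerodivisor of $R$. Here $\deg(\mathbb{X})=s$, $\mathrm{HF}_{\mathbb{X}}(i)=\dim_KR_i$ (similarly for subsets), and $r_{\mathbb{X}}$ is the least integer such that $\mathrm{HF}_{\mathbb{X}}(i)=s$ for all $i\ge r_{\mathbb{X}}$. $\mathbb{X}$ is $(i,j)$-uniform if every subscheme $\mathbb{Y}\subseteq\mathbb{X}$ of degree $\deg(\mathbb{X})-i$ satisfies $\mathrm{HF}_{\mathbb{Y}}(j)=\mathrm{HF}_{\mathbb{X}}(j)$. $Q^h(R)=R_{x_0}\cong\prod_{j=1}^sK[T_j,T_j^{-1}]$, $\deg T_j=1$, with $f\in R_i$ mapping to $(f(p_1)T_1^i,\dots,f(p_s)T_s^i)$, where points are written $p_j=(1:p_{j1}:\dots:p_{jn})$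 and $f(p_j)$ is the value of a representative at $(1,p_{j1},\dots,p_{jn})$. $L_0=K[x_0,x_0^{-1}]$, and $\sigma:Q^h(R)\to L_0$, $\sigma(h_1(T_1),\dots,h_s(T_s))=\sum_jh_j(x_0)$, is the canonical trace map, for which $\underline{\mathrm{Hom}}_{L_0}(Q^h(R),L_0)=Q^h(R)\cdot\sigma$. The Dedekind complementary module $\mathfrak{C}_{\mathbb{X}}\subseteq Q^h(R)$ is the image of the injection $\underline{\mathrm{Hom}}_{K[x_0]}(R,K[x_0])\to\underline{\mathrm{Hom}}_{L_0}(Q^h(R),L_0)=Q^h(R)\sigma\cong Q^h(R)$, $\varphi\mapsto\varphi\otimes\mathrm{id}_{L_0}$ (the last isomorphism sending $g\sigma$ to $g$). $\mathbb{X}$ is almost Gorenstein if there is an exact sequence of graded $R$-modules $0\to R\to\mathfrak{C}_{\mathbb{X}}(-r_{\mathbb{X}})\to C\to0$ (degree-zero maps) with $\mathfrak{m}\cdot C=\langle0\rangle$. *)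

(* Defs.v *)
From HB Require Import structures.
From mathcomp Require Import all_boot all_order all_algebra.
From mathcomp Require Import boolp mpoly.

Set Implicit Arguments.
Unset Strict Implicit.
Unset Printing Implicit Defensive.

Import GRing.Theory.
Local Open Scope ring_scope.
Local Open Scope quotient_scope.

Local Notation "x %:F" := (@tofrac _ x).

(* K[T, T^-1] is represented inside the field K(T). *)
Section Laurent.
Variable K : fieldType.

Definition laurent_pred : {pred {fraction {poly K}}} := fun z =>
  `[< exists (p : {poly K}) (k : nat), z = p%:F / ('X%:F) ^+ k >].

Lemma laurent_XF_neq0 k : ('X%:F : {fraction {poly K}}) ^+ k != 0.
Proof. by rewrite expf_neq0 // tofrac_eq0 polyX_eq0. Qed.

Lemma laurent_subring_closed : subring_closed laurent_pred.
Proof.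
split=> [|_ _ /asboolP[p [k ->]] /asboolP[q [l ->]]
         |_ _ /asboolP[p [k ->]] /asboolP[q [l ->]]]; apply/asboolP.
- by exists 1, 0%N; rewrite expr0 divr1 tofrac1.
- exists (p * 'X^l - q * 'X^k), (k + l)%N.
  rewrite tofracB !tofracM !tofracXn exprD mulrBl; congr (_ - _).
    by rewrite -mulf_div divff ?mulr1 // laurent_XF_neq0.
  by rewrite (mulrC q%:F ('X%:F ^+ k)) -mulf_div divff ?mul1r // laurent_XF_neq0.
- by exists (p * q), (k + l)%N; rewrite tofracM exprD mulf_div.
Qed.

HB.instance Definition _ :=
  GRing.isSubringClosed.Build {fraction {poly K}} laurent_pred
    laurent_subring_closed.

Record laurent := Laurent {
  frac_of_laurent :> {fraction {poly K}};
  _ : frac_of_laurent \in laurent_pred }.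

HB.instance Definition _ := [isSub for frac_of_laurent].
HB.instance Definition _ := [Choice of laurent by <:].
HB.instance Definition _ := [SubChoice_isSubComNzRing of laurent by <:].

Lemma tolaurent_subproof (p : {poly K}) : p%:F \in laurent_pred.
Proof. by apply/asboolP; exists p, 0%N; rewrite expr0 divr1. Qed.

Definition tolaurent (p : {poly K}) : laurent :=
  Laurent (tolaurent_subproof p).

Lemma tolaurent_is_zmod_morphism : zmod_morphism tolaurent.
Proof. by move=> p q; apply: val_inj; rewrite rmorphB /= tofracB. Qed.

Lemma tolaurent_is_monoid_morphism : monoid_morphism tolaurent.
Proof. by split=> [|p q]; apply: val_inj; rewrite ?rmorphM /= ?tofracM. Qed.

HB.instance Definition _ := GRing.isZmodMorphism.Build {poly K} laurent
  tolaurent tolaurent_is_zmod_morphism.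
HB.instance Definition _ := GRing.isMonoidMorphism.Build {poly K} laurent
  tolaurent tolaurent_is_monoid_morphism.

Definition laurent_piece (d : int) (z : laurent) : Prop :=
  exists c : K, val z = (c%:P)%:F * ('X%:F) ^ d.

Definition poly_piece (d : int) (p : {poly K}) : Prop :=
  if d is Posz k then exists c : K, p = c *: 'X^k else p = 0.

End Laurent.

(* A nonempty finite set of distinct K-rational points of P^n off the
   hyperplane X_0 = 0; [pt X j] lists the affine coordinates
   (p_j1, ..., p_jn) of p_j = (1 : p_j1 : ... : p_jn). *)
Record point_set (K : fieldType) (n : nat) := PointSet {
  deg : nat;
  deg_gt0 : (0 < deg)%N;
  pt : 'I_deg -> 'rV[K]_n;
  pt_inj : injective pt }.

Section PointSets.
Variables (K : fieldType) (n : nat) (X : point_set K n).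

Definition hcoord (j : 'I_(deg X)) (i : 'I_n.+1) : K :=
  if unlift ord0 i is Some k then pt j 0 k else 1.

(* A polynomial lies in the homogeneous vanishing ideal iff each of its
   homogeneous components vanishes at every point. *)
Definition vanishing_ideal : {pred {mpoly K[n.+1]}} := fun f =>
  [forall j : 'I_(deg X), forall d : 'I_(msize f),
     (pihomog [measure of mdeg] d f).@[hcoord j] == 0].

Definition evT (j : 'I_(deg X)) (f : {mpoly K[n.+1]}) : {poly K} :=
  \poly_(d < msize f) (pihomog [measure of mdeg] d f).@[hcoord j].

(* The ring morphism X_i |-> p_ji T, whose degree-d coefficient is f_d(p_j). *)
Definition evTm (j : 'I_(deg X)) : {mpoly K[n.+1]} -> {poly K} :=
  mmap (@polyC K) (fun i => hcoord j i *: 'X).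

HB.instance Definition _ j := GRing.RMorphism.on (evTm j).

Lemma coef_evTm j f d :
  (evTm j f)`_d = (pihomog [measure of mdeg] d f).@[hcoord j].
Proof.
rewrite /evTm /mmap coef_sum /pihomog raddf_sum /= [RHS]big_mkcond /=.
apply: eq_bigr => m _; rewrite coefCM mevalZ mevalX /mmap1.
under eq_bigr => i _ do rewrite exprZn.
rewrite scaler_prod coefZ prodrXr -mdegE coefXn eq_sym.
by case: eqP; rewrite ?mulr1 ?mulr0.
Qed.

Lemma evTE j f : evT j f = evTm j f.
Proof.
apply/polyP => d; rewrite coef_evTm coef_poly; case: ltnP => // le_d.
suff ->: pihomog [measure of mdeg] d f = 0 by rewrite meval0.
rewrite /pihomog big1_seq // => m /andP[/eqP dm /msize_mdeg_lt].
by move: dm => /= ->; rewrite ltnNge le_d.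
Qed.

Lemma vanishing_idealE f :
  (f \in vanishing_ideal) = [forall j, evTm j f == 0].
Proof.
apply: eq_forallb => j; apply/forallP/eqP => [H|H d].
  rewrite -evTE; apply/polyP => d; rewrite coef_poly coef0.
  by case: ltnP => // lt; exact: (eqP (H (Ordinal lt))).
by rewrite -coef_evTm H coef0.
Qed.

Lemma vanishing_ideal_closed : idealr_closed vanishing_ideal.
Proof.
split=> [||a u v].
- by rewrite vanishing_idealE; apply/forallP => j; rewrite rmorph0.
- rewrite vanishing_idealE; apply/forallP => /(_ (Ordinal (deg_gt0 X))).
  by rewrite rmorph1 oner_eq0.
- rewrite !vanishing_idealE => /forallP Hu /forallP Hv.
  apply/forallP => j; rewrite rmorphD rmorphM /=.
  by rewrite (eqP (Hu j)) (eqP (Hv j)) mulr0 addr0.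
Qed.

HB.instance Definition _ := isIdealr.Build {mpoly K[n.+1]} vanishing_ideal
  vanishing_ideal_closed.

Definition coord_ring := {ideal_quot vanishing_ideal}.

HB.instance Definition _ := GRing.ComNzRing.on coord_ring.

Local Notation R := coord_ring.

Definition residue (f : {mpoly K[n.+1]}) : R :=
  \pi_({ideal_quot vanishing_ideal}) f.

Lemma residue_is_zmod_morphism : zmod_morphism residue.
Proof. by move=> f g; rewrite /residue !piE. Qed.

Lemma residue_is_monoid_morphism : monoid_morphism residue.
Proof. by split=> [|f g]; rewrite /residue !piE. Qed.

HB.instance Definition _ := GRing.isZmodMorphism.Build {mpoly K[n.+1]} R residue
  residue_is_zmod_morphism.
HB.instance Definition _ := GRing.isMonoidMorphism.Build {mpoly K[n.+1]} R residue
  residue_is_monoid_morphism.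

Definition representative (r : R) : {mpoly K[n.+1]} :=
  repr (r : {ideal_quot vanishing_ideal}).

Lemma representativeK : cancel representative residue.
Proof. by move=> r; rewrite /residue reprK. Qed.

Lemma residue_eq (f g : {mpoly K[n.+1]}) :
  (residue f == residue g) = (f - g \in vanishing_ideal).
Proof. by rewrite Quotient.idealrBE. Qed.

Definition R_piece (d : int) (r : R) : Prop :=
  if d is Posz k then
    exists f : {mpoly K[n.+1]}, f \is k.-homog /\ r = residue f
  else r = 0.

Definition irrelevant (r : R) : Prop :=
  exists f : {mpoly K[n.+1]}, f@_0%MM = 0 /\ r = residue f.

(* The K[x_0]-module structure of R; {poly K} plays the role of K[x_0]. *)
Definition x0_poly (c : {poly K}) : R :=
  residue (map_poly (@mpolyC n.+1 K) c).['X_ord0].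

Lemma x0_poly_is_zmod_morphism : zmod_morphism x0_poly.
Proof. by move=> p q; rewrite /x0_poly rmorphB hornerD hornerN rmorphB. Qed.

Lemma x0_poly_is_monoid_morphism : monoid_morphism x0_poly.
Proof.
split=> [|p q]; first by rewrite /x0_poly rmorph1 hornerC rmorph1.
by rewrite /x0_poly rmorphM hornerM rmorphM.
Qed.

HB.instance Definition _ := GRing.isZmodMorphism.Build {poly K} R x0_poly
  x0_poly_is_zmod_morphism.
HB.instance Definition _ := GRing.isMonoidMorphism.Build {poly K} R x0_poly
  x0_poly_is_monoid_morphism.

Fact x0_scaleA c d (r : R) : x0_poly c * (x0_poly d * r) = x0_poly (c * d) * r.
Proof. by rewrite rmorphM mulrA. Qed.
Fact x0_scale1 (r : R) : x0_poly 1 * r = r.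
Proof. by rewrite rmorph1 mul1r. Qed.
Fact x0_scaleDr c (r t : R) : x0_poly c * (r + t) = x0_poly c * r + x0_poly c * t.
Proof. exact: mulrDr. Qed.
Fact x0_scaleDl (r : R) c d : x0_poly (c + d) * r = x0_poly c * r + x0_poly d * r.
Proof. by rewrite rmorphD mulrDl. Qed.

HB.instance Definition _ := GRing.Zmodule_isLmodule.Build {poly K} R
  x0_scaleA x0_scale1 x0_scaleDr x0_scaleDl.

(* The homogeneous ring of quotients Q^h(R) = \prod_j K[T_j, T_j^-1]. *)
Definition Qh := {ffun 'I_(deg X) -> laurent K}.

HB.instance Definition _ := GRing.PzRing.on Qh.

Definition Qh_piece (d : int) (h : Qh) : Prop :=
  forall j, laurent_piece d (h j).

(* f in R_i is sent to (f(p_1) T_1^i, ..., f(p_s) T_s^i). *)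
Definition Qh_emb (r : R) : Qh := [ffun j => tolaurent (evT j (representative r))].

Lemma Qh_emb_residue (f : {mpoly K[n.+1]}) :
  Qh_emb (residue f) = [ffun j => tolaurent (evTm j f)].
Proof.
apply/ffunP => j; rewrite !ffunE evTE; congr tolaurent.
apply/eqP; rewrite -subr_eq0 -rmorphB.
have: representative (residue f) - f \in vanishing_ideal.
  by rewrite -residue_eq representativeK.
by rewrite vanishing_idealE => /forallP/(_ j).
Qed.

Lemma Qh_emb_is_zmod_morphism : zmod_morphism Qh_emb.
Proof.
move=> r t; rewrite -[r]representativeK -[t]representativeK -rmorphB.
by rewrite !Qh_emb_residue; apply/ffunP => j; rewrite !ffunE !rmorphB.
Qed.

Lemma Qh_emb_is_monoid_morphism : monoid_morphism Qh_emb.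
Proof.
split=> [|r t].
  rewrite -(rmorph1 residue) Qh_emb_residue.
  by apply/ffunP => j; rewrite !ffunE !rmorph1.
rewrite -[r]representativeK -[t]representativeK -rmorphM.
by rewrite !Qh_emb_residue; apply/ffunP => j; rewrite !ffunE !rmorphM.
Qed.

HB.instance Definition _ := GRing.isZmodMorphism.Build R Qh Qh_emb
  Qh_emb_is_zmod_morphism.
HB.instance Definition _ := GRing.isMonoidMorphism.Build R Qh Qh_emb
  Qh_emb_is_monoid_morphism.

Fact Qh_scaleA a b (h : Qh) : Qh_emb a * (Qh_emb b * h) = Qh_emb (a * b) * h.
Proof. by rewrite rmorphM mulrA. Qed.
Fact Qh_scale1 (h : Qh) : Qh_emb 1 * h = h.
Proof. by rewrite rmorph1 mul1r. Qed.
Fact Qh_scaleDr a (h k : Qh) : Qh_emb a * (h + k) = Qh_emb a * h + Qh_emb a * k.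
Proof. exact: mulrDr. Qed.
Fact Qh_scaleDl (h : Qh) a b : Qh_emb (a + b) * h = Qh_emb a * h + Qh_emb b * h.
Proof. by rewrite rmorphD mulrDl. Qed.

HB.instance Definition _ := GRing.Zmodule_isLmodule.Build R Qh
  Qh_scaleA Qh_scale1 Qh_scaleDr Qh_scaleDl.

(* L_0 = K[x_0, x_0^-1] sits diagonally in Q^h(R), since x_0 takes the value 1
   at every point. *)
Definition diag (l : laurent K) : Qh := [ffun=> l].

Definition trace (h : Qh) : laurent K := \sum_j h j.

Definition homogeneous_map (e : int) (psi : R -> {poly K}) : Prop :=
  forall (i : int) (r : R), R_piece i r -> poly_piece (i + e) (psi r).

(* The graded dual: finite sums of homogeneous K[x_0]-linear maps. *)
Definition in_graded_dual (phi : R -> {poly K}) : Prop :=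
  exists (I : finType) (e : I -> int) (psi : I -> {linear R -> {poly K}^o}),
    (forall k, homogeneous_map (e k) (psi k)) /\
    (forall r, phi r = \sum_k psi k r).

(* [phi (x) id_{L_0} = g sigma] on R (x)_{K[x_0]} L_0 = Q^h(R), stated on the
   pure tensors r (x) l, which correspond to [Qh_emb r * diag l]. *)
Definition represents (g : Qh) (phi : R -> {poly K}) : Prop :=
  forall (r : R) (l : laurent K),
    trace (g * (Qh_emb r * diag l)) = tolaurent (phi r) * l.

Definition dedekind_pred : {pred Qh} := fun g =>
  `[< exists phi, in_graded_dual phi /\ represents g phi >].

Lemma in_graded_dual0 : in_graded_dual (fun=> 0).
Proof.
exists 'I_0, (fun=> 0), (fun=> \0); split=> [[]|r] //.
by rewrite big_ord0.
Qed.

Lemma in_graded_dualD phi psi : in_graded_dual phi -> in_graded_dual psi ->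
  in_graded_dual (fun r => phi r + psi r).
Proof.
move=> [I [d [u [Hu Eu]]]] [J [e [v [Hv Ev]]]].
exists (I + J)%type, (fun k => match k with inl i => d i | inr j => e j end).
exists (fun k => match k with inl i => u i | inr j => v j end).
by split=> [[i|j]|r]; rewrite ?big_sumType //= Eu Ev.
Qed.

Lemma R_pieceM i j (r t : R) :
  R_piece i r -> R_piece j t -> R_piece (i + j) (r * t).
Proof.
have R0 k : R_piece k (0 : R).
  by case: k => k //=; exists 0; rewrite rpred0 rmorph0.
case: i => i; last by move=> ->; rewrite mul0r.
case: j => j; last by move=> _ ->; rewrite mulr0.
move=> [f [hf ->]] [g [hg ->]]; exists (f * g).
by rewrite dhomogM // rmorphM.
Qed.

Section MulLinear.
Variables (a : R) (psi : {linear R -> {poly K}^o}).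
Definition mul_dual (r : R) : {poly K}^o := psi (a * r).
Lemma mul_dual_is_linear : linear mul_dual.
Proof.
by move=> c r t; rewrite /mul_dual mulrDr -linearP; congr (psi (_ + _)); exact: mulrCA.
Qed.
HB.instance Definition _ := GRing.isLinear.Build {poly K} R {poly K}^o _ mul_dual
  mul_dual_is_linear.
End MulLinear.

Lemma in_graded_dualZ (a : R) phi : in_graded_dual phi ->
  in_graded_dual (fun r => phi (a * r)).
Proof.
move=> [I [e [u [Hu Eu]]]]; pose f := representative a.
pose N := mmeasure [measure of mdeg] f.
pose c (d : 'I_N) : R := residue (pihomog [measure of mdeg] d f).
have Ea : a = \sum_d c d.
  rewrite -[LHS]representativeK -/f -rmorph_sum; congr residue.
  exact: pihomog_partitionE.
exists (I * 'I_N)%type, (fun k => Posz (nat_of_ord k.2) + e k.1).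
exists (fun k => mul_dual (c k.2) (u k.1)).
split=> [[k d] i r /= Hr|r].
  rewrite addrA; apply: Hu; rewrite [i + _]addrC; apply: R_pieceM => //.
  by exists (pihomog [measure of mdeg] d f); rewrite pihomogP.
rewrite Eu -(pair_bigA _ (fun k d => mul_dual (c d) (u k) r)) /=.
by apply: eq_bigr => k _; rewrite {1}Ea mulr_suml linear_sum.
Qed.

Lemma trace_is_zmod_morphism : zmod_morphism trace.
Proof.
by move=> g h; rewrite /trace -sumrB; apply: eq_bigr => j _; rewrite !ffunE.
Qed.

HB.instance Definition _ := GRing.isZmodMorphism.Build Qh (laurent K) trace
  trace_is_zmod_morphism.

Lemma Qh_mulC (g h : Qh) : g * h = h * g.
Proof. by apply/ffunP => j; rewrite !ffunE mulrC. Qed.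

Lemma dedekind_submod_closed : submod_closed dedekind_pred.
Proof.
split=> [|a u v /asboolP[phi [Hphi Ephi]] /asboolP[psi [Hpsi Epsi]]].
  apply/asboolP; exists (fun=> 0); split; first exact: in_graded_dual0.
  by move=> r l; rewrite mul0r [trace _]raddf0 rmorph0 mul0r.
apply/asboolP; exists (fun r => phi (a * r) + psi r); split.
  by apply: in_graded_dualD => //; apply: in_graded_dualZ.
move=> r l; rewrite mulrDl raddfD /= Epsi rmorphD mulrDl; congr (_ + _).
rewrite -Ephi (rmorphM Qh_emb); congr (trace _).
by rewrite [a *: u](Qh_mulC (Qh_emb a) u) !mulrA.
Qed.

HB.instance Definition _ :=
  GRing.isSubmodClosed.Build R Qh dedekind_pred dedekind_submod_closed.

Record dedekind := Dedekind {
  Qh_of_dedekind :> Qh;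
  _ : Qh_of_dedekind \in dedekind_pred }.

HB.instance Definition _ := [isSub for Qh_of_dedekind].
HB.instance Definition _ := [Choice of dedekind by <:].
HB.instance Definition _ := [SubChoice_isSubLmodule of dedekind by <:].

Definition dedekind_piece (d : int) (g : dedekind) : Prop :=
  Qh_piece d (val g).

(* An R-module M = \bigoplus_i M_i with R_i M_j contained in M_(i+j). *)
Definition is_grading (M : lmodType R) (M_ : int -> M -> Prop) : Prop :=
  [/\ forall i, M_ i 0,
      forall i u v, M_ i u -> M_ i v -> M_ i (u - v),
      forall i j (r : R) v, R_piece i r -> M_ j v -> M_ (i + j) (r *: v),
      forall v, exists (s : seq int) (w : int -> M),
        (forall i, M_ i (w i)) /\ v = \sum_(i <- s) w i
    & forall (s : seq int) (w : int -> M), uniq s -> (forall i, M_ i (w i)) ->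
        \sum_(i <- s) w i = 0 -> {in s, forall i, w i = 0}].

(* Exactness of 0 -> R -> C_X(-r) -> C -> 0; the degree-i part of C_X(-r) is
   the degree-(i - r) part of C_X. *)
Definition short_exact (r : int) (C : lmodType R) (C_ : int -> C -> Prop)
    (alpha : {linear R^o -> dedekind}) (beta : {linear dedekind -> C}) : Prop :=
  [/\ forall i (a : R), R_piece i a -> dedekind_piece (i - r) (alpha a),
      forall i g, dedekind_piece (i - r) g -> C_ i (beta g),
      injective alpha,
      forall c, exists g, beta g = c
    & forall g, beta g = 0 <-> exists a, alpha a = g].

Definition ev (d : nat) (j : 'I_(deg X)) (f : dhomog n.+1 K d) : K^o :=
  (f : {mpoly K[n.+1]}).@[hcoord j].

Lemma ev_is_linear d j : linear (@ev d j).
Proof. by move=> c f g; rewrite /ev !linearP. Qed.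

HB.instance Definition _ d j := GRing.isLinear.Build K (dhomog n.+1 K d) K^o _
  (@ev d j) (@ev_is_linear d j).

(* The degree-d part of the vanishing ideal of the subset Y of X. *)
Definition vanishing_piece (Y : {set 'I_(deg X)}) (d : nat) :
    {vspace dhomog n.+1 K d} :=
  (\bigcap_(j in Y) lker (linfun (@ev d j)))%VS.

Lemma vanishing_piece_ideal d (f : dhomog n.+1 K d) :
  (f \in vanishing_piece setT d) = (mpoly_of_dhomog f \in vanishing_ideal).
Proof.
rewrite memvE; apply/subv_bigcapP/idP => [H|]; rewrite vanishing_idealE.
  apply/forallP => j; apply/eqP/polyP => e; rewrite coef_evTm coef0.
  have [<-|ne] := eqVneq d e.
    rewrite pihomog_dE; last exact: (dhomog_is_dhomog f).
    by have := H j (in_setT j); rewrite -memvE memv_ker lfunE => /eqP.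
  by rewrite (pihomog_ne0 ne (dhomog_is_dhomog f)) meval0.
move/forallP=> H j _; rewrite -memvE memv_ker lfunE /= /ev.
have /eqP/polyP/(_ d) := H j; rewrite coef_evTm coef0.
by rewrite pihomog_dE => [->|]; last exact: (dhomog_is_dhomog f).
Qed.

(* HF_Y(d) = dim_K P_d / (I_Y)_d. *)
Definition HF (Y : {set 'I_(deg X)}) (d : nat) : nat :=
  (\dim (fullv : {vspace dhomog n.+1 K d}) - \dim (vanishing_piece Y d))%N.

Definition HFX (d : nat) : nat := HF setT d.

Definition sep (j k : 'I_(deg X)) : {mpoly K[n.+1]} :=
  if [pick c | pt j 0 c != pt k 0 c] is Some c then
    'X_(lift ord0 c) - pt k 0 c *: 'X_ord0 else 0.

Lemma sepP (j k : 'I_(deg X)) : k != j ->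
  [/\ sep j k \is 1.-homog, (sep j k).@[hcoord k] = 0
    & (sep j k).@[hcoord j] != 0].
Proof.
move=> ne; rewrite /sep; case: pickP => [c Hc|H]; last first.
  case/eqP: ne; apply: (@pt_inj _ _ X); apply/rowP => c.
  by have /negbFE/eqP -> := H c.
have hX (i : 'I_n.+1) : ('X_i : {mpoly K[n.+1]}) \is 1.-homog.
  by rewrite dhomogX /= mdeg1.
split.
- by rewrite rpredB // rpredZ.
- by rewrite mevalB mevalZ !mevalXU /hcoord liftK unlift_none mulr1 subrr.
- by rewrite mevalB mevalZ !mevalXU /hcoord liftK unlift_none mulr1 subr_eq0.
Qed.

Lemma separator d (j : 'I_(deg X)) : (deg X <= d.+1)%N ->
  exists f : dhomog n.+1 K d, forall k, ev k f = (k == j)%:R.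
Proof.
move=> le_d.
pose g : {mpoly K[n.+1]} := \prod_(k | k != j) sep j k.
have hg : g \is (\sum_(k < deg X | k != j) 1)%N.-homog.
  rewrite /g; apply: (big_rec2 (fun m (q : {mpoly K[n.+1]}) => q \is m.-homog)).
    exact: dhomog1.
  by move=> k m q ne hq; apply: dhomogM => //; case: (sepP ne).
have Ec : (\sum_(k < deg X | k != j) 1 = (deg X).-1)%N.
  by rewrite sum1_card cardC1 card_ord.
rewrite Ec in hg; pose h := g * 'X_ord0 ^+ (d - (deg X).-1).
have hh : h \is d.-homog.
  have -> : d = ((deg X).-1 + 1 * (d - (deg X).-1))%N.
    by rewrite mul1n subnKC // -ltnS prednK ?deg_gt0.
  apply: dhomogM; rewrite ?mul1n ?addKn //.
  have := @dhomogMn n.+1 K [measure of mdeg] 1 'X_ord0 (d - (deg X).-1).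
  by rewrite mul1n; apply; rewrite dhomogX /= mdeg1.
have hX k : ('X_ord0 ^+ (d - (deg X).-1) : {mpoly K[n.+1]}).@[hcoord k] = 1.
  by rewrite rmorphXn /= mevalXU /hcoord unlift_none expr1n.
have gj : g.@[hcoord j] != 0.
  rewrite /g rmorph_prod /=; apply/prodf_neq0 => k ne.
  by case: (sepP ne).
exists ((g.@[hcoord j])^-1 *: DHomog hh) => k.
rewrite linearZ /= /ev /= mevalM hX mulr1.
have [->|ne] := eqVneq k j; first by rewrite [_ *: _]mulVf.
have -> : g.@[hcoord k] = 0; last by rewrite scaler0.
by rewrite /g (bigD1 k) //= mevalM; case: (sepP ne) => _ -> _; rewrite mul0r.
Qed.

Definition ev_all d (f : dhomog n.+1 K d) : 'rV[K]_(deg X) := \row_j ev j f.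

Lemma ev_all_is_linear d : linear (@ev_all d).
Proof. by move=> c f g; apply/rowP => j; rewrite !mxE linearP. Qed.

HB.instance Definition _ d := GRing.isLinear.Build K (dhomog n.+1 K d)
  'rV[K]_(deg X) _ (@ev_all d) (@ev_all_is_linear d).

Lemma HF_full d : (deg X <= d.+1)%N -> HFX d = deg X.
Proof.
move=> le_d; pose EL := @ev_all d.
have Eker : vanishing_piece setT d = lker (linfun EL).
  apply/vspaceP => f; rewrite memv_ker lfunE /= memvE.
  apply/subv_bigcapP/eqP => [H|H j _].
    apply/rowP => j; rewrite !mxE; apply/eqP.
    by have := H j (in_setT j); rewrite -memvE memv_ker lfunE.
  rewrite -memvE memv_ker lfunE /=.
  by move/rowP/(_ j): H; rewrite !mxE => ->.
have Eim : limg (linfun EL) = fullv.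
  apply/vspaceP => v; rewrite memvf.
  rewrite (row_sum_delta v); apply: memv_suml => j _; apply: memvZ.
  have [f Hf] := separator j le_d.
  suff -> : delta_mx 0 j = linfun EL f by rewrite memv_img ?memvf.
  by rewrite lfunE; apply/rowP => k; rewrite !mxE Hf eqxx.
have := limg_ker_dim (linfun EL) fullv.
rewrite /HFX /HF Eker capfv Eim => <-; rewrite addKn dimvf.
by rewrite dim_matrix mul1r.
Qed.

Lemma regularity_exists :
  exists r, `[< forall i, (r <= i)%N -> HFX i = deg X >].
Proof.
exists (deg X); apply/asboolP => i le_i; apply: HF_full.
exact: leq_trans le_i _.
Qed.

(* HF_X vanishes in negative degrees while deg X > 0, so the least integer r_X
   is a natural number. *)
Definition reg_index : nat := ex_minn regularity_exists.

(* Subschemes of the reduced scheme X of degree deg X - i are the subsets of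
   deg X - i points. *)
Definition uniform (i j : nat) : Prop :=
  forall Y : {set 'I_(deg X)}, (#|Y| + i)%N = deg X -> HF Y j = HFX j.

Definition almost_Gorenstein : Prop :=
  exists (C : lmodType R) (C_ : int -> C -> Prop)
         (alpha : {linear R^o -> dedekind}) (beta : {linear dedekind -> C}),
    [/\ is_grading C_, short_exact reg_index C_ alpha beta
      & forall (a : R) (c : C), irrelevant a -> a *: c = 0].

(* The index r_X - 1 is meant for 0 < r_X. *)
Definition Delta : nat := (deg X - HFX reg_index.-1)%N.

End PointSets.

(* Main.v *)
(* Let V_i be the set of vectors (f(p_1), ..., f(p_s)) in K^s with f in R_i, and
   r = r_X.  The degree -r part of C_X is W = V_(r-1)^perp.  Let c in W be the
   image of 1 in R.  As the cokernel of R -> C_X(-r) is killed by the maximal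
   ideal, V_1 W is contained in V_1 c.  By (2, r-1)-uniformity, V_(r-1) contains
   no nonzero vector supported on two points; dually W surjects onto K^2 for any
   two coordinates.  Hence c has no zero coordinate, and for j <> k some w in
   W / c satisfies w_j <> 0, w_k = 0 and w V_1 <= V_1.  Multiplying 1 by such w
   for all k <> j puts the j-th unit vector into V_1, hence into V_(r-1) as
   r >= 2, against uniformity.  So the hypotheses of the theorem are jointly
   contradictory: already uniformity alone gives dim V_(r-1) <= s - 2. *)
From HB Require Import structures.
Require Import Defs.
From mathcomp Require Import all_boot all_order all_algebra.
From mathcomp Require Import boolp mpoly.

Set Implicit Arguments.
Unset Strict Implicit.
Unset Printing Implicit Defensive.

Import GRing.Theory.
Local Open Scope ring_scope.

Section Points.
Variables (K : fieldType) (n : nat) (X : point_set K n).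
Implicit Types (f g : {mpoly K[n.+1]}) (h : 'I_(deg X) -> K).

(* In degree -d-1, C_X consists of the (h_j T_j^(-d-1)) with h as below. *)
Definition orthogonal_to_degree d h :=
  forall f, f \is d.-homog -> \sum_j h j * f.@[hcoord j] = 0.

(** * Values of forms at the points, and uniformity with its dual form *)

Lemma hcoord0 (j : 'I_(deg X)) : hcoord j ord0 = 1.
Proof. by rewrite /hcoord unlift_none. Qed.

Lemma X0_homog : ('X_ord0 : {mpoly K[n.+1]}) \is 1.-homog.
Proof. by rewrite dhomogX /= mdeg1. Qed.

Lemma meval_X0 (j : 'I_(deg X)) : ('X_ord0 : {mpoly K[n.+1]}).@[hcoord j] = 1.
Proof. by rewrite mevalXU hcoord0. Qed.

Lemma homog_raise d e f : f \is d.-homog -> (d <= e)%N ->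
  exists2 g, g \is e.-homog &
    forall j : 'I_(deg X), g.@[hcoord j] = f.@[hcoord j].
Proof.
move=> hf le_de; exists (f * 'X_ord0 ^+ (e - d)) => [|j].
  rewrite -(subnKC le_de); apply: dhomogM => //; rewrite addKn.
  by have := dhomogMn (e - d) X0_homog; rewrite mul1n.
by rewrite mevalM rmorphXn /= meval_X0 expr1n mulr1.
Qed.

(** For [Y] the complement of the two points, $I_X \subseteq I_Y$, and equal Hilbert functions at
    [d] force equality in degree [d]. *)
Lemma uniform2_vanish d (j k : 'I_(deg X)) f : uniform X 2 d -> j != k ->
  f \is d.-homog ->
  (forall l, l != j -> l != k -> f.@[hcoord l] = 0) -> f.@[hcoord j] = 0.
Proof.
move=> unif ne hf vf; pose Y := ~: [set j; k].
have cY : (#|Y| + 2)%N = deg X.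
  by rewrite -[RHS]card_ord -(cardsC [set j; k]) cards2 ne addnC.
have sub : (vanishing_piece (X := X) setT d <= vanishing_piece Y d)%VS.
  apply/subv_bigcapP => l _; exact: (bigcapv_inf l).
have eqd : \dim (vanishing_piece (X := X) setT d) = \dim (vanishing_piece Y d).
  have leY := dimvS (subvf (vanishing_piece Y d)).
  have leT := dimvS (subvf (vanishing_piece (X := X) setT d)).
  (* [HF] is a truncated difference; the bounds by $\dim P_d$ allow the dimensions to be recovered
     from it. *)
  by rewrite -(subKn leT) -(subKn leY); congr (_ - _)%N; rewrite -[LHS](unif Y cY).
have eqV : vanishing_piece (X := X) setT d = vanishing_piece Y d.
  by apply/eqP; rewrite -(dimv_leqif_eq sub) eqd.
have : DHomog hf \in vanishing_piece Y d.
  rewrite memvE; apply/subv_bigcapP => l; rewrite !inE negb_or => /andP[lj lk].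
  by rewrite -memvE memv_ker lfunE /= /ev /= vf.
rewrite -eqV memvE => /subv_bigcapP /(_ j (in_setT j)).
by rewrite -memvE memv_ker lfunE /= /ev /= => /eqP.
Qed.

(** Let [B] be the evaluation matrix [A] with columns [j] and [k] zeroed. By [uniform2_vanish] the
    left kernel of [B] kills column [j] of [A], so this column lies in the column span of [B]. *)
Lemma uniform2_dual d (j k : 'I_(deg X)) : uniform X 2 d -> j != k ->
  exists h, [/\ h j = 1, h k = 0 & orthogonal_to_degree d h].
Proof.
move=> unif ne; pose b := vbasis (fullv : {vspace dhomog n.+1 K d}).
pose A := \matrix_(i, l) ev l b`_i :
  'M[K]_(\dim (fullv : {vspace dhomog n.+1 K d}), deg X).
pose B := \matrix_(i, l) if (l == j) || (l == k) then 0 else A i l.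
have ker (u : 'rV_(_)) : u *m B = 0 -> u *m col j A = 0.
  move=> uB; pose f : dhomog n.+1 K d := \sum_i u 0 i *: b`_i.
  have fE l : ev l f = (u *m A) 0 l.
    by rewrite linear_sum !mxE; apply: eq_bigr => i _; rewrite linearZ /= !mxE.
  apply/rowP => z; have := fE j.
  rewrite -[LHS]/((f : {mpoly K[n.+1]}).@[hcoord j]) !mxE => Ej.
  transitivity (f : {mpoly K[n.+1]}).@[hcoord j].
    by rewrite Ej; apply: eq_bigr => i _; rewrite !mxE.
  apply: (@uniform2_vanish d j k _ unif ne) => [|l lj lk].
    exact: dhomog_is_dhomog.
  have /rowP/(_ l) := uB; rewrite !mxE => <-.
  have := fE l; rewrite mxE /ev => ->.
  by apply: eq_bigr => i _; rewrite [B _ _]mxE (negPf lj) (negPf lk).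
have : ((col j A)^T <= B^T)%MS.
  rewrite submxE -[X in X == _]trmxK trmx_mul trmxK; apply/eqP.
  rewrite -[RHS]trmx0; congr trmx; apply/row_matrixP => i.
  rewrite row_mul row0; apply: ker.
  by rewrite -row_mul -[in X in _ *m X](trmxK B) -trmx_mul mulmx_coker trmx0 row0.
case/submxP => u uB.
(* The unit vector at [j] minus the solution [u], whose entries at [j] and [k] can be reset to 0
   because these columns of [B] vanish. *)
pose h l := (l == j)%:R - if (l == j) || (l == k) then 0 else u 0 l.
have Ah i : \sum_l h l * A i l = 0.
  have /matrixP/(_ i ord0) := congr1 trmx uB.
  rewrite trmx_mul !trmxK !mxE => AE.
  under eq_bigr do rewrite mulrBl.
  rewrite sumrB (bigD1 j) //= big1 ?addr0 => [|l /negPf ->]; last by rewrite mul0r.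
  apply/eqP; rewrite eqxx mul1r subr_eq0 [A i j]mxE AE; apply/eqP.
  apply: eq_bigr => l _; rewrite !mxE; case: ifP => _; rewrite ?mul0r //.
  by rewrite mulrC.
exists h; split=> [||f hf].
- by rewrite /h eqxx subr0.
- by rewrite /h [k == j]eq_sym (negPf ne) eqxx orbT subrr.
have -> : f = DHomog hf by [].
rewrite -[LHS]/(\sum_l h l * ev l (DHomog hf)).
rewrite (coord_vbasis (memvf (DHomog hf))).
under eq_bigr do rewrite linear_sum mulr_sumr.
rewrite exchange_big big1 // => i _ /=.
under eq_bigr do rewrite linearZ /= mulrCA.
rewrite -mulr_sumr (_ : \sum_l _ = 0) ?mulr0 // -[RHS](Ah i).
by apply: eq_bigr => l _; rewrite mxE.
Qed.

Lemma orthogonal_lower d e h : orthogonal_to_degree d h -> (e <= d)%N ->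
  orthogonal_to_degree e h.
Proof.
move=> oh le_ed f hf; have [g hg eg] := homog_raise hf le_ed.
by rewrite -[RHS](oh g hg); apply: eq_bigr => j _; rewrite eg.
Qed.

(** * The trace pairing of a vector of scalars with $R$ *)

Lemma tolaurent_inj : injective (@tolaurent K).
Proof. by move=> p q /(congr1 val) /= /eqP; rewrite tofrac_eq => /eqP. Qed.

Lemma evT_representative (j : 'I_(deg X)) f :
  evT j (representative (residue X f)) = evTm j f.
Proof.
apply: tolaurent_inj.
by have /ffunP/(_ j) := Qh_emb_residue X f; rewrite !ffunE.
Qed.

Lemma evTm_x0 (j : 'I_(deg X)) (p : {poly K}) :
  evTm j (map_poly (@mpolyC n.+1 K) p).['X_ord0] = p.
Proof.
have X0 : evTm j 'X_ord0 = 'X by rewrite /evTm mmapX mmap1U hcoord0 scale1r.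
rewrite -[LHS](horner_map (evTm j)) /= X0 -map_poly_comp.
rewrite -[RHS]comp_polyXr /comp_poly; congr _.['X]; apply/polyP => i.
by rewrite !coef_map /= /evTm mmapC.
Qed.

(** This is $a \mapsto \sigma((h_1,\dots,h_s)\,a)$, with values in $K[x_0]$. *)
Definition pairing h (a : coord_ring X) : {poly K} :=
  \sum_j h j *: evT j (representative a).

Lemma pairing_residue h f : pairing h (residue X f) = \sum_j h j *: evTm j f.
Proof. by apply: eq_bigr => j _; rewrite evT_representative. Qed.

Lemma coef_pairing h f i :
  (pairing h (residue X f))`_i
    = \sum_j h j * (pihomog [measure of mdeg] i f).@[hcoord j].
Proof.
rewrite pairing_residue coef_sum; apply: eq_bigr => j _.
by rewrite coefZ coef_evTm.
Qed.

Lemma pairing_is_linear h : linear (pairing h : _ -> {poly K}^o).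
Proof.
move=> p a b; rewrite -[a]representativeK -[b]representativeK.
rewrite -[p *: _]/(residue X (map_poly (@mpolyC n.+1 K) p).['X_ord0] * _) -rmorphM -rmorphD !pairing_residue.
rewrite [_ *: _]mulr_sumr -big_split; apply: eq_bigr => j _ /=.
by rewrite rmorphD rmorphM /= evTm_x0 scalerDr scalerAr.
Qed.

Lemma pairing_homog h i f : f \is i.-homog ->
  pairing h (residue X f) = (\sum_j h j * f.@[hcoord j]) *: 'X^i.
Proof.
move=> hf; apply/polyP => k; rewrite coef_pairing coefZ coefXn.
have [->|ne] := eqVneq k i; first by rewrite mulr1 pihomog_dE.
by rewrite mulr0 big1 // => j _; rewrite (pihomog_ne0 _ hf) 1?eq_sym // meval0 mulr0.
Qed.

Lemma poly_piece0 (e : int) : poly_piece e (0 : {poly K}).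
Proof. by case: e => // e; exists 0; rewrite scale0r. Qed.

(** * Elements of $\mathfrak{C}_X$ and the almost Gorenstein condition *)

Section Shift.
Variables (d : nat) (h : 'I_(deg X) -> K).
Hypothesis oh : orthogonal_to_degree d h.

(** Truncating division by $x_0^{d+1}$. Orthogonality in degree [d], hence in lower degrees, makes
    it exact, giving the functional of $(h_j T_j^{-d-1})_j$. *)
Definition shifted_pairing (a : coord_ring X) : {poly K}^o :=
  drop_poly d.+1 (pairing h a).

Lemma shifted_pairingE a : shifted_pairing a * 'X^(d.+1) = pairing h a.
Proof.
rewrite -[RHS](poly_take_drop d.+1) -[LHS]add0r; congr (_ + _).
apply/polyP => i; rewrite coef0 coef_take_poly; case: ifP => // lt_id.
rewrite -[a]representativeK coef_pairing; apply/esym.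
exact: (orthogonal_lower oh lt_id (pihomogP _ _ _)).
Qed.

Lemma shifted_pairing_is_linear : linear shifted_pairing.
Proof.
move=> p a b; have XN : 'X^(d.+1) != 0 :> {poly K} by rewrite monic_neq0 ?monicXn.
apply: (mulIf XN); rewrite mulrDl [p *: shifted_pairing a]/(p * _) -mulrA !shifted_pairingE.
exact: pairing_is_linear.
Qed.

Lemma shifted_pairing_homogeneous :
  homogeneous_map (- (Posz d.+1)) shifted_pairing.
Proof.
move=> [i|i] a /=; last first.
  move=> ->; rewrite -(addNr 0) -scaleN1r shifted_pairing_is_linear.
  by rewrite scaleN1r addNr.
move=> [f [hf ->]]; rewrite /shifted_pairing (pairing_homog _ hf).
case: (leqP i d) => [le_id|lt_di].
  by rewrite (orthogonal_lower oh le_id hf) scale0r drop_poly0r; exact: poly_piece0.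
rewrite subzn //; exists (\sum_j h j * f.@[hcoord j]).
rewrite linearZ /=; congr (_ *: _); apply/polyP => k.
by rewrite coef_drop_poly !coefXn -[in LHS](subnK lt_di) eqn_add2r.
Qed.
End Shift.

Lemma laurent_monomial_subproof (c : K) k :
  (tofrac c%:P) / (tofrac 'X) ^+ k \in @laurent_pred K.
Proof. by apply/asboolP; exists c%:P, k. Qed.

Definition laurent_monomial c k := Laurent (laurent_monomial_subproof c k).

Lemma monomial_dedekind d h : orthogonal_to_degree d h ->
  [ffun j => laurent_monomial (h j) d.+1] \in dedekind_pred (X := X).
Proof.
move=> oh; apply/asboolP; exists (shifted_pairing d h); split.
  exists 'I_1, (fun=> - (Posz d.+1)).
  pose phi : {linear coord_ring X -> {poly K}^o} :=
    HB.pack (@shifted_pairing d h) (GRing.isLinear.Build _ _ _ _ _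
      (shifted_pairing_is_linear oh)).
  exists (fun=> phi); split=> [_|a]; last by rewrite big_ord1.
  exact: shifted_pairing_homogeneous.
move=> a l; rewrite /trace.
under eq_bigr do rewrite !ffunE mulrA.
rewrite -mulr_suml; congr (_ * _); apply: val_inj.
have XN := laurent_XF_neq0 K d.+1.
rewrite raddf_sum /=; apply: (mulIf XN).
rewrite -tofracXn -tofracM (shifted_pairingE oh) raddf_sum mulr_suml tofracXn.
apply: eq_bigr => j _; rewrite /= mulrAC divfK //.
by rewrite -tofracM mul_polyC.
Qed.

(** Take for [c] the coefficients of $\alpha(1)$, of degree $-r_X$. The element $w = (h_j
    T_j^{-r_X})_j$ lies in $\mathfrak{C}_X$, and $fw$ dies in $C$ since $f \in \mathfrak{m}$; by
    exactness $fw = b\,\alpha(1)$ for some $b \in R$. *)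
Lemma almost_Gorenstein_mul : almost_Gorenstein X -> (0 < reg_index X)%N ->
  exists c : 'I_(deg X) -> K,
  forall h f, orthogonal_to_degree (reg_index X).-1 h -> f \is 1.-homog ->
  exists2 g, g \is 1.-homog &
    forall j, f.@[hcoord j] * h j = g.@[hcoord j] * c j.
Proof.
move=> [C [C_ [al [be [_ [al_deg _ _ _ ex] kill]]]]] r_gt0.
have R1 : R_piece 0 (1 : (coord_ring X)^o).
  by exists 1; rewrite dhomog1 rmorph1.
have [c cE] := choice (al_deg 0 1 R1).
exists c => h f oh hf.
have hD := monomial_dedekind oh; rewrite prednK // in hD.
have f0 : f@_0%MM = 0.
  by apply: (dhomog_nemf_coeff hf); rewrite /= mdeg0.
have /ex [b bE] : be (residue X f *: Dedekind hD) = 0.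
  by rewrite linearZ /= kill //; exists f.
pose F := representative b.
(* Homogeneity of [b] is not known, but after cancelling $T_j^{-r_X}$ only the coefficient of $T_j$
   is compared. *)
exists (pihomog [measure of mdeg] 1 F) => [|j]; first exact: pihomogP.
have bEj : residue X f *: Dedekind hD = (b : coord_ring X) *: al 1.
  by rewrite -bE -linearZ; congr (al _); rewrite /= [RHS]mulr1.
have /(congr1 val) : Qh_emb (residue X f) j * val (Dedekind hD) j =
  Qh_emb b j * val (al 1) j.
  by have /ffunP/(_ j) := congr1 val bEj; rewrite [LHS]ffunE [RHS]ffunE.
rewrite Qh_emb_residue !ffunE /= cE sub0r -exprnN mulrA [RHS]mulrA.
have XN : (tofrac 'X : {fraction {poly K}}) ^- reg_index X != 0.
  by rewrite invr_eq0 laurent_XF_neq0.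
move/(mulIf XN)/eqP; rewrite -!tofracM tofrac_eq => /eqP/(congr1 (coefp 1)) /=.
by rewrite !coefMC evTE !coef_evTm pihomog_dE.
Qed.

(** * A linear form separating one point from all others *)

Lemma deg_ge2 : (1 < reg_index X)%N -> (1 < deg X)%N.
Proof.
apply: contraTT; rewrite -!leqNgt => le1; rewrite /reg_index.
case: ex_minnP => m _ m_min; apply: leq_trans (m_min 0%N _) _ => //.
by apply/asboolP => i _; apply: HF_full; exact: leq_trans le1 _.
Qed.

Lemma linear_separator (j : 'I_(deg X)) :
  uniform X 2 (reg_index X).-1 -> almost_Gorenstein X ->
  (1 < reg_index X)%N ->
  exists2 g, g \is 1.-homog &
    g.@[hcoord j] != 0 /\ forall l, l != j -> g.@[hcoord l] = 0.
Proof.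
move=> unif aG r_gt1.
have [c cP] := almost_Gorenstein_mul aG (ltnW r_gt1).
(* With $f = X_0$ and $h_l = 1$ the relation reads $1 = g(p_l)c_l$. *)
have c_neq0 l k : l != k -> c l != 0.
  move=> ne; have [h [hl _ oh]] := uniform2_dual unif ne.
  have [g _ /(_ l)] := cP h _ oh X0_homog.
  rewrite meval_X0 hl mulr1 => E; apply/eqP => c0; move/eqP: E.
  by rewrite c0 mulr0 oner_eq0.
(* Induction on the list of points to be killed, starting from $X_0$. *)
suff: forall s : seq 'I_(deg X), exists2 g, g \is 1.-homog &
    g.@[hcoord j] != 0 /\ {in s, forall l, l != j -> g.@[hcoord l] = 0}.
  move=> /(_ (enum 'I_(deg X))) [g hg [gj gl]]; exists g => //; split=> // l.
  by apply: gl; rewrite mem_enum.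
elim=> [|k s [f hf [fj fs]]].
  by exists 'X_ord0; [exact: X0_homog | rewrite meval_X0 oner_eq0].
have [->|ne] := eqVneq k j.
  exists f => //; split=> // l; rewrite inE => /predU1P[->|/fs //].
  by rewrite eqxx.
(* Passing from [f] to $fh/c$ keeps the value at [j] nonzero, adds a zero at [k] and preserves the
   earlier zeros. *)
rewrite eq_sym in ne; have [h [hj hk oh]] := uniform2_dual unif ne.
have [g hg gE] := cP h f oh hf; exists g => //; split=> [|l].
  apply: contraNneq fj => g0; have := gE j.
  by rewrite hj mulr1 g0 mul0r => ->.
rewrite inE => /predU1P ls lj; apply: (mulIf (c_neq0 l j lj)).
by rewrite mul0r -gE; case: ls => [->|/fs ->]; rewrite ?hk ?mulr0 ?mul0r.
Qed.

End Points.

Local Close Scope ring_scope.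

Theorem proposition6p13 (K : fieldType) (n : nat) (X : point_set K n) :
  uniform X 2 (reg_index X).-1 ->
  almost_Gorenstein X ->
  (2 <= reg_index X)%N ->
  Delta X = 1%N.
Proof.
move=> unif aG r_gt1; exfalso.
have deg_gt1 := deg_ge2 r_gt1.
pose j := Ordinal (deg_gt0 X); pose k := Ordinal deg_gt1.
have [f hf [fj fl]] := linear_separator j unif aG r_gt1.
(* The bound $r_X \ge 2$ lets a linear form be raised to degree $r_X - 1$, where uniformity
   applies. *)
have le1r : (1 <= (reg_index X).-1)%N by rewrite -ltnS prednK // ltnW.
have [g hg gE] := homog_raise X hf le1r.
case/eqP: fj; rewrite -gE; apply: (uniform2_vanish (k := k) unif) => // l lj _.
by rewrite gE fl.
Qed.
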